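(* For every integer $n\geq 2$, $b_t(G_{n,3})=1$.
   Context: All graphs are finite, undirected, without loops or multiple edges. For positive integers $n,m$, the $(n,m)$-grid graph $G_{n,m}=P_n\times P_m$ is the Cartesian product of the paths $P_n$ and $P_m$: its vertex set is $\{x_{ij} : 1\le i\le n,\ 1\le j\le m\}$, and $x_{ij}$ and $x_{i'j'}$ are adjacent if and only if either $i=i'$ and $|j-j'|=1$, or $j=j'$ and $|i-i'|=1$. For a graph $G$ without isolated vertices, a total dominating set of $G$ is a set $D\subseteq V(G)$ such that every vertex of $G$ (including those in $D$) has at least one neighbor in $D$. The total domination number $\gamma_t(G)$ is the minimum cardinality of a total dominating set of $G$. The total bondage number $b_t(G)$ of a graph $G$ without isolated vertices is the minimum cardinality of a set $B\subseteq E(G)$ of edges such that the graph $G-B$ obtained by removing the edges in $B$ (keeping all vertices) has no isolated vertices and satisfies $\gamma_t(G-B)>\gamma_t(G)$; if no such $B$ exists, $b_t(G)=\infty$. *)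

(* Defs.v *)
From mathcomp Require Import all_boot ssralg ssrint.
Set Implicit Arguments.
Unset Strict Implicit.
Unset Printing Implicit Defensive.

Record sgraph := SGraph {
  svertex :> finType;
  adj : rel svertex;
  adj_sym : symmetric adj;
  adj_irrefl : irreflexive adj
}.
Arguments adj {s}.
Arguments SGraph : clear implicits.

Section TotalBondage.
Variable G : sgraph.
Implicit Types (D : {set G}) (B : {set {set G}}).

Definition edges : {set {set G}} :=
  [set [set p.1; p.2] | p : G * G & adj p.1 p.2].

Definition no_isolated : bool := [forall x : G, [exists y : G, adj x y]].

Definition total_dominating D : bool :=
  [forall x : G, [exists y in D, adj x y]].

Lemma total_dominating_setT : total_dominating [set: G] = no_isolated.
Proof.
by apply: eq_forallb => x; apply: eq_existsb => y; rewrite in_setT.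
Qed.

(* By [total_dominating_setT], this is the minimum cardinality as soon as there
   is no isolated vertex; otherwise the value carries no information. *)
Definition total_domination_number : nat :=
  #|[arg min_(D < [set: G] | total_dominating D) #|D|]|.

Definition del_adj B : rel G :=
  fun x y => adj x y && ([set x; y] \notin B).

Lemma del_adj_sym B : symmetric (del_adj B).
Proof. by move=> x y; rewrite /del_adj adj_sym setUC. Qed.

Lemma del_adj_irrefl B : irreflexive (del_adj B).
Proof. by move=> x; rewrite /del_adj adj_irrefl. Qed.

Definition del_edges B : sgraph :=
  SGraph G (del_adj B) (@del_adj_sym B) (@del_adj_irrefl B).

End TotalBondage.

Definition total_bondage_set (G : sgraph) (B : {set {set G}}) : bool :=
  [&& B \subset edges G, no_isolated (del_edges B) &
      total_domination_number G < total_domination_number (del_edges B)].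

(* [None] stands for infinity.  Meant for graphs without isolated vertices. *)
Definition total_bondage_number (G : sgraph) : option nat :=
  if [pick B : {set {set G}} | total_bondage_set B] is Some B0 then
    Some #|[arg min_(B < B0 | total_bondage_set B) #|B|]|
  else None.

Section Grid.
Variables n m : nat.

(* The vertex x_{ij} is the pair of ordinals (i - 1, j - 1). *)
Definition grid_adj : rel ('I_n * 'I_m) := fun x y =>
  ((x.1 == y.1) && (`|x.2 - y.2|%N == 1)) ||
  ((x.2 == y.2) && (`|x.1 - y.1|%N == 1)).

Lemma grid_adj_sym : symmetric grid_adj.
Proof.
move=> x y; rewrite /grid_adj (eq_sym x.1) (eq_sym x.2).
by rewrite (distnC x.1) (distnC x.2).
Qed.

Lemma grid_adj_irrefl : irreflexive grid_adj.
Proof. by move=> x; rewrite /grid_adj !distnn !andbF. Qed.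

Definition grid : sgraph :=
  SGraph ('I_n * 'I_m)%type grid_adj grid_adj_sym grid_adj_irrefl.

End Grid.

(* Main.v *)
Require Import Defs.
From mathcomp Require Import all_boot.
From mathcomp Require Import zify.

Set Implicit Arguments.
Unset Strict Implicit.
Unset Printing Implicit Defensive.

(** The upper bound on the total domination number of the grid comes from its
    middle column, which is a total dominating set of size [n].

    For the lower bound after deleting an edge, count incidences with the two
    outer columns, which have [2 * n] vertices.  Every vertex of the grid has at
    most two neighbours there: a middle vertex has the two at its sides, an outer
    vertex the ones above and below it.  Hence a total dominating set of size
    [n] can only exist if each of its members has exactly two outer neighbours
    ([card_lt_total_dominating]).  Now delete the edge joining the middle vertex
    of the second row to its left neighbour.  The middle vertex of the first
    row must still be dominated, by a corner of the first row or by the middle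
    vertex of the second row.  A corner has a single outer neighbour, and so does
    the middle vertex of the second row once the edge is gone; so no total
    dominating set of the new graph has [n] vertices or fewer.  As deleting no
    edge changes nothing, one edge is optimal. *)

(** * Total domination in arbitrary graphs *)

Section TotalDomination.
Variable G : sgraph.
Implicit Types (D W : {set G}) (B : {set {set G}}) (u v : G).

Definition neighbors u : {set G} := [set v : G | adj u v].

Lemma total_dominatingP D :
  reflect (forall v, exists2 u, u \in D & adj v u) (total_dominating D).
Proof.
apply: (iffP forallP) => [domD v | domD v].
  by have /existsP [u /andP [uD vu]] := domD v; exists u.
by have [u uD vu] := domD v; apply/existsP; exists u; rewrite uD.
Qed.

Lemma total_dominatingW D : total_dominating D -> no_isolated G.
Proof.
move=> /total_dominatingP domD; apply/forallP => v.
by have [u _ vu] := domD v; apply/existsP; exists u.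
Qed.

Lemma total_domination_number_le D :
  total_dominating D -> total_domination_number G <= #|D|.
Proof.
move=> domD; rewrite /total_domination_number.
case: arg_minnP => [|D0 _]; last exact.
by rewrite total_dominating_setT (total_dominatingW domD).
Qed.

Lemma total_domination_number_attained :
  no_isolated G ->
  exists2 D : {set G}, total_dominating D & #|D| = total_domination_number G.
Proof.
rewrite -total_dominating_setT /total_domination_number => domT.
by case: arg_minnP => // D domD _; exists D.
Qed.

(** Double counting of the adjacent pairs in [D * W]: each vertex of [W] lies in
    at least one of them, each vertex of [D] in at most [k], and the vertex [u0]
    in fewer. *)
Lemma card_lt_total_dominating D W k u0 :
  total_dominating D -> (forall u, #|neighbors u :&: W| <= k) ->
  u0 \in D -> #|neighbors u0 :&: W| < k ->
  #|W| < k * #|D|.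
Proof.
move=> /total_dominatingP domD degW u0D degu0.
have leW : #|W| <= \sum_(u in D) #|neighbors u :&: W|.
  have -> : \sum_(u in D) #|neighbors u :&: W|
            = \sum_(v in W) #|neighbors v :&: D|.
    transitivity (\sum_(u in D) \sum_(v in W | adj u v) 1).
      apply: eq_bigr => u _; rewrite -sum1_card; apply: eq_bigl => v.
      by rewrite !inE andbC.
    rewrite (exchange_big_dep (mem W)) /=; last by move=> u v _ /andP [].
    apply: eq_bigr => v vW; rewrite -sum1_card; apply: eq_bigl => u.
    by rewrite !inE vW adj_sym andbC.
  rewrite -sum1_card; apply: leq_sum => v _.
  have [u uD vu] := domD v; rewrite card_gt0; apply/set0Pn.
  by exists u; rewrite !inE vu.
apply: leq_ltn_trans leW _.
rewrite mulnC -sum_nat_const (bigD1 u0) //= [ltnRHS](bigD1 u0) //= -addSn.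
by apply: leq_add => //; apply: leq_sum.
Qed.

End TotalDomination.

Lemma total_domination_number_del0 (G : sgraph) :
  no_isolated G ->
  total_domination_number (del_edges (set0 : {set {set G}}))
  <= total_domination_number G.
Proof.
move=> /total_domination_number_attained [D /total_dominatingP domD <-].
apply: (@total_domination_number_le (del_edges set0)).
apply/total_dominatingP => v; have [u uD vu] := domD v.
by exists u => //=; rewrite /del_adj vu inE.
Qed.

(** A single edge is optimal because [total_domination_number_del0] rules out the
    empty set. *)
Lemma total_bondage_number_eq1 (G : sgraph) (e : {set G}) :
  no_isolated G -> total_bondage_set [set e] ->
  total_bondage_number G = Some 1.
Proof.
move=> isoG bonde; rewrite /total_bondage_number.
case: pickP => [B0 bondB0 | none]; last by rewrite none in bonde.
case: arg_minnP => // B bondB minB; congr Some; apply/eqP.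
rewrite eqn_leq -[X in _ <= X](cards1 e) minB //= card_gt0.
apply/eqP => B0E; move: bondB; rewrite B0E => /and3P [_ _].
by rewrite ltnNge total_domination_number_del0.
Qed.

(** * The grid with three columns *)

Section ThreeColumns.
Variable n : nat.
Local Notation G := (grid n.+2 3).
Implicit Types u v : G.

(** Reading coordinates as natural numbers, here and in [grid_adjE], leaves
    adjacency questions to linear arithmetic. *)
Definition row u : nat := u.1.
Definition col u : nat := u.2.
Definition cell i j : G := (inord i, inord j).

Lemma ltn_row u : row u < n.+2. Proof. exact: ltn_ord. Qed.
Lemma ltn_col u : col u < 3. Proof. exact: ltn_ord. Qed.

Lemma row_cell i j : i < n.+2 -> row (cell i j) = i.
Proof. exact: inordK. Qed.

Lemma col_cell i j : j < 3 -> col (cell i j) = j.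
Proof. exact: inordK. Qed.

Lemma eq_cell u i j : row u = i -> col u = j -> u = cell i j.
Proof. by case: u => [i' j'] <- <-; rewrite /cell !inord_val. Qed.

Lemma grid_adjE u v :
  adj u v =
    ((row u == row v) &&
       (((col u).+1 == col v) || ((col v).+1 == col u))) ||
    ((col u == col v) &&
       (((row u).+1 == row v) || ((row v).+1 == row u))).
Proof.
rewrite /= /grid_adj -!val_eqE /= -/(row u) -/(row v) -/(col u) -/(col v).
lia.
Qed.

Definition middle_column : {set G} := [set v : G | col v == 1].
Definition outer_columns : {set G} := [set v : G | col v != 1].

Lemma card_middle_column : #|middle_column| = n.+2.
Proof.
have -> : middle_column = setX [set: 'I_n.+2] [set inord 1 : 'I_3].
  by apply/setP => v; rewrite !inE -val_eqE /= inordK.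
by rewrite cardsX cardsT card_ord cards1 muln1.
Qed.

Lemma card_outer_columns : #|outer_columns| = 2 * n.+2.
Proof.
have -> : outer_columns = setX [set: 'I_n.+2] [set~ inord 1 : 'I_3].
  by apply/setP => v; rewrite !inE -val_eqE /= inordK.
by rewrite cardsX cardsT card_ord cardsC1 card_ord mulnC.
Qed.

Lemma exists_adjacent_row u :
  exists2 k, k < n.+2 & ((row u).+1 == k) || (k.+1 == row u).
Proof.
have := ltn_row u; case: (row u) => [|i] lti; first by exists 1.
by exists i; [exact: ltnW | rewrite eqxx orbT].
Qed.

Lemma total_dominating_middle_column : total_dominating middle_column.
Proof.
apply/total_dominatingP => v; have ltv := ltn_row v.
have [v2 | v2] := eqVneq (col v) 1.
  have [k ltk adjk] := exists_adjacent_row v.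
  exists (cell k 1); first by rewrite inE col_cell.
  by rewrite grid_adjE row_cell // col_cell // v2 adjk orbT.
exists (cell (row v) 1); first by rewrite inE col_cell.
by rewrite grid_adjE row_cell // col_cell //; have := ltn_col v; lia.
Qed.

Lemma outer_neighbors_middle u :
  col u = 1 ->
  neighbors u :&: outer_columns \subset [set cell (row u) 0; cell (row u) 2].
Proof.
move=> u2; apply/subsetP => v; rewrite !inE grid_adjE u2 => /andP [adjuv v2].
have : col v = 0 \/ col v = 2 by have := ltn_col v; lia.
by case=> v2E; apply/orP; [left | right]; apply/eqP; apply: eq_cell; lia.
Qed.

Lemma outer_neighbors_outer u :
  col u != 1 ->
  neighbors u :&: outer_columns
    \subset [set cell (row u).-1 (col u); cell (row u).+1 (col u)].
Proof.
move=> u2; apply/subsetP => v; rewrite !inE grid_adjE => /andP [adjuv v2].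
have := ltn_col u; have := ltn_col v => ltv ltu.
have : row v = (row u).-1 \/ row v = (row u).+1 by lia.
by case=> v1E; apply/orP; [left | right]; apply/eqP; apply: eq_cell; lia.
Qed.

Lemma outer_neighbors_corner u :
  row u = 0 -> col u != 1 ->
  neighbors u :&: outer_columns \subset [set cell 1 (col u)].
Proof.
move=> u1 u2; apply/subsetP => v; rewrite !inE grid_adjE => /andP [adjuv v2].
have := ltn_col u; have := ltn_col v => ltv ltu.
by apply/eqP/eq_cell; lia.
Qed.

Lemma outer_degree_le2 u : #|neighbors u :&: outer_columns| <= 2.
Proof.
have card2 a b : #|[set a; b] : {set G}| <= 2 by rewrite cards2; case: eqP.
have [u2 | u2] := eqVneq (col u) 1.
  exact: leq_trans (subset_leq_card (outer_neighbors_middle u2)) (card2 _ _).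
exact: leq_trans (subset_leq_card (outer_neighbors_outer u2)) (card2 _ _).
Qed.

(** * Deleting the left edge at the middle of the second row *)

Definition cut : {set G} := [set cell 1 0; cell 1 1].

Definition grid_cut := del_edges [set cut].

Lemma cut_edge : cut \in edges G.
Proof.
apply/imsetP; exists (cell 1 0, cell 1 1) => //.
by rewrite inE grid_adjE !row_cell // !col_cell.
Qed.

Lemma cutP u : u \in cut -> row u = 1 /\ col u <= 1.
Proof. by rewrite !inE => /orP [] /eqP ->; rewrite row_cell // col_cell. Qed.

(** The deleted edge is horizontal and joins the two left columns, so every middle
    vertex keeps the edge to its right and every outer vertex its vertical
    edges. *)
Lemma no_isolated_grid_cut : no_isolated grid_cut.
Proof.
apply/forallP => u; apply/existsP; have ltu := ltn_row u.
have [u2 | u2] := eqVneq (col u) 1.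
  exists (cell (row u) 2).
  rewrite /= /del_adj grid_adjE row_cell // col_cell // u2 eqxx /= inE.
  apply/eqP => cutE; have /cutP [_] : cell (row u) 2 \in cut.
    by rewrite -cutE set22.
  by rewrite col_cell.
have [k ltk adjk] := exists_adjacent_row u.
exists (cell k (col u)).
rewrite /= /del_adj grid_adjE row_cell // col_cell ?ltn_col //.
rewrite eqxx adjk orbT inE; apply/eqP => cutE.
have /cutP [k1 _] : cell k (col u) \in cut by rewrite -cutE set22.
have /cutP [u1 _] : u \in cut by rewrite -cutE set21.
by move: k1 adjk; rewrite row_cell // u1 => ->.
Qed.

(** Every vertex dominating the middle vertex of the first row has at most one
    outer neighbour, so [card_lt_total_dominating] with [k = 2] is strict. *)
Lemma lt_total_domination_grid_cut : n.+2 < total_domination_number grid_cut.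
Proof.
have [D domD <-] := total_domination_number_attained no_isolated_grid_cut.
rewrite -(ltn_pmul2l (isT : 0 < 2)) -card_outer_columns.
have subN (u : grid_cut) :
    neighbors u :&: outer_columns \subset neighbors (u : G) :&: outer_columns.
  by apply: setSI; apply/subsetP => v; rewrite !inE => /andP [].
have [u uD] := total_dominatingP _ domD (cell 0 1).
rewrite /= /del_adj grid_adjE row_cell // col_cell // => /andP [adju _].
apply: (card_lt_total_dominating domD _ uD) => [w|].
  exact: leq_trans (subset_leq_card (subN w)) (outer_degree_le2 w).
have := ltn_col u => ltu.
have [u2 | u2] := eqVneq (col u) 1; last first.
  have u1 : row u = 0 by lia.
  have := subset_trans (subN u) (outer_neighbors_corner u1 u2).
  by move/subset_leq_card; rewrite cards1.
have uE : u = cell 1 1 by apply: eq_cell; lia.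
(* The outer neighbours of [cell 1 1] in the grid are [cell 1 0], now cut off,
   and [cell 1 2]. *)
rewrite ltnS -(cards1 (cell 1 2)); apply: subset_leq_card.
apply/subsetP => v vN.
have := subsetP (subset_trans (subN u) (outer_neighbors_middle u2)) v vN.
rewrite !inE uE row_cell // => /orP [] // /eqP vE.
by move: vN; rewrite !inE /= /del_adj inE vE uE setUC eqxx andbF.
Qed.

Lemma total_bondage_set_cut : total_bondage_set [set cut].
Proof.
apply/and3P; split; first by rewrite sub1set cut_edge.
  exact: no_isolated_grid_cut.
apply: leq_ltn_trans lt_total_domination_grid_cut.
rewrite -[leqRHS]card_middle_column.
exact: total_domination_number_le total_dominating_middle_column.
Qed.

End ThreeColumns.

Theorem theorem4p1 (n : nat) (hn : 2 <= n) :
  total_bondage_number (grid n 3) = Some 1.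
Proof.
case: n hn => [|[|n]] // _.
apply: total_bondage_number_eq1 (total_bondage_set_cut n).
exact: total_dominatingW (total_dominating_middle_column n).
Qed.
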